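(* Let $(X,T)$ be a topological dynamical system with a metric $d$ having weak tame growth of covering numbers, and let $g$ be a mistake function. Then $$\overline{\mathrm{mdim}}_{FK}(T,X,d)=\overline{\mathrm{mdim}}_{M}(T,X,d)=\overline{\mathrm{mdim}}_{M}(g;T,X).$$ Consequently, if $d$ has tame growth of covering numbers, then $$\overline{\mathrm{mdim}}_{FK}(T,X,d)=\overline{\mathrm{mdim}}_{M}(T,X,d)=\overline{\mathrm{mdim}}_{\hat M}(T,X,d)=\overline{\mathrm{mdim}}_{M}(g;T,X).$$
   Context: A topological dynamical system $(X,T)$ with a metric $d$ is a non-empty compact metric space $(X,d)$ together with a homeomorphism $T:X\to X$. All limits superior take values in $[0,\infty]$. For $\epsilon>0$, $B_d(x,\epsilon)=\{y\in X: d(x,y)<\epsilon\}$ and $\#(X,d,\epsilon)$ is the smallest number of open balls $B_d(x,\epsilon)$, $x \in X$, needed to cover $X$. **Growth conditions.** $(X,d)$ has tame growth of covering numbers if for each $\theta>0$, $\lim_{\epsilon\to0}\epsilon^{\theta}\log\#(X,d,\epsilon)=0$. It has weak tame growth of covering numbers if $\lim_{\epsilon\to0}\epsilon\log\#(X,d,\epsilon)=0$. **Feldman–Katok (FK) metric.** For $x,y\in X$, $n\ge 1$, $\delta>0$, an $(n,\delta)$-match of $x$ and $y$ is an order preserving bijection $\pi:D(\pi)\to R(\pi)$ (i.e. $\pi(i)<\pi(j)$ whenever $i<j$) with $D(\pi),R(\pi)\subset\{0,1,\dots,n-1\}$ and $d(T^{i}x,T^{\pi(i)}y)<\delta$ for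 every $i\in D(\pi)$. Let $|\pi|$ be the cardinality of $D(\pi)$, and set $$\bar f_{n,\delta}(x,y)=1-\tfrac1n\max\{|\pi|:\pi\text{ is an }(n,\delta)\text{-match of }x\text{ and }y\},\qquad d_{FK_n}(x,y)=\inf\{\delta>0:\bar f_{n,\delta}(x,y)<\delta\}.$$ Let $r_{FK}(T,X,n,d,\epsilon)$ be the smallest cardinality of a set $E\subset X$ such that for every $x\in X$ there is $y\in E$ with $d_{FK_n}(x,y)<\epsilon$. Put $r_{FK}(T,X,d,\epsilon)=\limsup_{n\to\infty}\frac1n\log r_{FK}(T,X,n,d,\epsilon)$ and $$\overline{\mathrm{mdim}}_{FK}(T,X,d)=\limsup_{\epsilon\to0}\frac{r_{FK}(T,X,d,\epsilon)}{\log\frac1\epsilon}.$$ **Bowen metric.** $d_n(x,y)=\max_{0\le j\le n-1}d(T^jx,T^jy)$. Let $r_n(T,X,d,\epsilon)$ be the smallest cardinality of a set $E\subset X$ such that for every $x\in X$ there is $y\in E$ with $d_n(x,y)<\epsilon$, and $$\overline{\mathrm{mdim}}_{M}(T,X,d)=\limsup_{\epsilon\to0}\limsup_{n\to\infty}\frac{\log r_n(T,X,d,\epsilon)}{n\log\frac1\epsilon}.$$ **Mean metric.** $\bar d_n(x,y)=\frac1n\sum_{j=0}^{n-1}d(T^jx,T^jy)$. Let $\hat r_n(T,X,d,\epsilon)$ be the smallest cardinality of a set $E\subset X$ such that for every $x\in X$ there is $y\in E$ with $\bar d_n(x,y)<\epsilon$, and $$\overline{\mathrm{mdim}}_{\hat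 M}(T,X,d)=\limsup_{\epsilon\to0}\limsup_{n\to\infty}\frac{\log \hat r_n(T,X,d,\epsilon)}{n\log\frac1\epsilon}.$$ **Mistake function.** A mistake function is a non-decreasing unbounded map $g$ from the positive integers to the non-negative integers with $g(n)<n$ for all $n$ and $\lim_{n\to\infty}g(n)/n=0$. Let $I(g;n)$ be the set of all subsets $\Lambda$ of $\{0,1,\dots,n-1\}$ with $|\Lambda|\ge n-g(n)$. Let $r_n(g;T,X,\epsilon)$ be the smallest cardinality of a set $E\subset X$ such that for every $x\in X$ there exist $y\in E$ and $\Lambda\in I(g;n)$ with $\max_{j\in\Lambda}d(T^jx,T^jy)<\epsilon$. Put $r(g;T,X,\epsilon)=\limsup_{n\to\infty}\frac1n\log r_n(g;T,X,\epsilon)$ and $$\overline{\mathrm{mdim}}_{M}(g;T,X)=\limsup_{\epsilon\to0}\frac{r(g;T,X,\epsilon)}{\log\frac1\epsilon}.$$ *)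

(* Defs.v *)
From HB Require Import structures.
From mathcomp Require Import all_boot all_order all_algebra finmap.
From mathcomp Require Import all_classical all_reals all_analysis.

Set Implicit Arguments.
Unset Strict Implicit.
Unset Printing Implicit Defensive.

Import Order.TTheory GRing.Theory Num.Theory.
Import numFieldNormedType.Exports.

Local Open Scope classical_set_scope.
Local Open Scope ring_scope.

Definition homeomorphism (X Y : topologicalType) (T : X -> Y) : Prop :=
  continuous T /\
  exists S : Y -> X, [/\ continuous S, cancel T S & cancel S T].

Section covering_and_spanning_numbers.
Context {R : realType} {X : metricType R}.

(* Cardinalities of finite sets are taken in \bar R, so that the infimum is a
   minimum when some finite set is admissible and is +oo when none is. *)
Definition min_card (admissible : set {fset X}) : \bar R :=
  ereal_inf [set (#|` E|%:R)%:E | E in admissible].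

Definition covering_number (e : R) : \bar R :=
  min_card [set E | [set: X] `<=` \bigcup_(x in [set` E]) ball x e].

Definition spanning_number (near : X -> X -> Prop) : \bar R :=
  min_card [set E | forall x, exists2 y, y \in E & near x y].

End covering_and_spanning_numbers.

Section growth.
Context {R : realType} (X : metricType R).

Definition tame_growth : Prop := forall theta : R, 0 < theta ->
  ((e `^ theta)%:E * lne (covering_number (X := X) e))%E @[e --> 0^'+]
    --> 0%E.

Definition weak_tame_growth : Prop :=
  (e%:E * lne (covering_number (X := X) e))%E @[e --> 0^'+] --> 0%E.

End growth.

(* Only the values of g at positive integers are constrained or used. *)
Definition mistake_function (R : realType) (g : nat -> nat) : Prop :=
  [/\ forall m n, (0 < m)%N -> (m <= n)%N -> (g m <= g n)%N,
      forall M, exists2 n, (0 < n)%N & (M < g n)%N,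
      forall n, (0 < n)%N -> (g n < n)%N
    & ((g n)%:R / n%:R : R) @[n --> \oo] --> (0 : R)].

Definition mistake_sets (g : nat -> nat) (n : nat) : set {set 'I_n} :=
  [set L | (n - g n <= #|L|)%N].
Arguments mistake_sets : clear implicits.

Section metric_mean_dimensions.
Context {R : realType} {X : metricType R} (T : X -> X).

(* A match is given by its domain D and by a map p on 'I_n of which only the
   restriction to D matters; its range is p @: D. *)
Definition is_match (n : nat) (delta : R) (x y : X)
    (D : {set 'I_n}) (p : {ffun 'I_n -> 'I_n}) : Prop :=
  [/\ {in D &, injective p},
      {in D &, forall i j : 'I_n, (i < j)%N -> (p i < p j)%N}
    & {in D, forall i : 'I_n, mdist (iter i T x) (iter (p i) T y) < delta}].

Definition max_match (n : nat) (delta : R) (x y : X) : nat :=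
  \max_(q : {set 'I_n} * {ffun 'I_n -> 'I_n}
        | `[< is_match delta x y q.1 q.2 >]) #|q.1|.

Definition fbar (n : nat) (delta : R) (x y : X) : R :=
  1 - n%:R^-1 * (max_match n delta x y)%:R.

Definition dist_FK (n : nat) (x y : X) : R :=
  inf [set delta | 0 < delta /\ fbar n delta x y < delta].

(* Distances are nonnegative, so 0 is a neutral default value for max. *)
Definition dist_on (n : nat) (L : {set 'I_n}) (x y : X) : R :=
  \big[Num.max/0]_(j in L) mdist (iter j T x) (iter j T y).

Definition dist_Bowen (n : nat) (x y : X) : R := dist_on [set: 'I_n]%SET x y.

Definition dist_mean (n : nat) (x y : X) : R :=
  n%:R^-1 * \sum_(j < n) mdist (iter j T x) (iter j T y).

Definition r_FK (n : nat) (e : R) : \bar R :=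
  spanning_number (fun x y => dist_FK n x y < e).

Definition r_Bowen (n : nat) (e : R) : \bar R :=
  spanning_number (fun x y => dist_Bowen n x y < e).

Definition r_mean (n : nat) (e : R) : \bar R :=
  spanning_number (fun x y => dist_mean n x y < e).

Definition r_mistake (g : nat -> nat) (n : nat) (e : R) : \bar R :=
  spanning_number (fun x y => exists2 L, mistake_sets g n L &
    dist_on L x y < e).

Definition exp_rate_FK (e : R) : \bar R :=
  limn_esup (fun n => (n%:R^-1)%:E * lne (r_FK n e))%E.

Definition mdim_FK : \bar R :=
  limf_esup (fun e : R => ((ln e^-1)^-1)%:E * exp_rate_FK e)%E 0^'+.

Definition mdim_M : \bar R :=
  limf_esup (fun e : R =>
    limn_esup (fun n => ((n%:R * ln e^-1)^-1)%:E * lne (r_Bowen n e))%E) 0^'+.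

Definition mdim_mean : \bar R :=
  limf_esup (fun e : R =>
    limn_esup (fun n => ((n%:R * ln e^-1)^-1)%:E * lne (r_mean n e))%E) 0^'+.

Definition exp_rate_mistake (g : nat -> nat) (e : R) : \bar R :=
  limn_esup (fun n => (n%:R^-1)%:E * lne (r_mistake g n e))%E.

Definition mdim_mistake (g : nat -> nat) : \bar R :=
  limf_esup (fun e : R => ((ln e^-1)^-1)%:E * exp_rate_mistake g e)%E 0^'+.

End metric_mean_dimensions.

(* Main.v *)
(** Each of the weaker closeness relations (Feldman-Katok, mean, mistake) is
    implied by Bowen closeness, so [mdim_M] is the largest of the four
    quantities; it remains to bound it by the others.  Each relation at scale
    [e] provides a match, at scale [e ^ a], of [x] with a point [y] of the
    spanning set that misses at most [eta n] times; here [a = 1] and [eta = e],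
    except for the mean metric, where [a < 1] is arbitrary and Markov's
    inequality gives [eta = e ^ (1 - a)].  An increasing match is determined by
    its domain and its range, hence there are at most [4 ^ n] of them, and
    recording a covering ball at each missed time pins [x] down to Bowen
    distance [2 e ^ a].  The Bowen spanning number is thus larger by a factor of
    at most [4 ^ n N(e ^ a) ^ (eta n)], whose exponential growth rate
    [ln 4 + eta ln N(e ^ a)] stays bounded by the growth condition on covering
    numbers and is therefore negligible against [ln (1 / e)]. *)
Require Import Defs.
From mathcomp Require Import all_boot all_order all_algebra finmap.
From mathcomp Require Import all_classical all_reals all_analysis.
From mathcomp Require Import lra.

Set Implicit Arguments.
Unset Strict Implicit.
Unset Printing Implicit Defensive.

Import Order.TTheory GRing.Theory Num.Theory.
Import numFieldNormedType.Exports.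

Local Open Scope classical_set_scope.
Local Open Scope ring_scope.

(** * Rigidity of increasing maps *)

(** By strong induction on [i]: if [p i < q i], then [p i = q j] for some [j < i] in [D]. By
    induction [p j = q j = p i], against monotonicity of [p]. *)
Lemma increasing_image_inj n (D : {set 'I_n}) (p q : 'I_n -> 'I_n) :
  {in D &, forall i j : 'I_n, (i < j)%N -> (p i < p j)%N} ->
  {in D &, forall i j : 'I_n, (i < j)%N -> (q i < q j)%N} ->
  p @: D = q @: D -> {in D, p =1 q}.
Proof.
move=> pmono qmono pqD i.
have [m] := ubnP i; elim: m i p q pmono qmono pqD => // m IH i p q.
wlog pq : p q / (p i <= q i)%N => [wlg pmono qmono pqD im iD|].
  have [/wlg|/ltnW/wlg] := leqP (p i) (q i); first exact.
  by move=> /(_ qmono pmono (esym pqD) im iD)/esym.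
move=> pmono qmono pqD im iD; apply: val_inj; apply/eqP => /=.
rewrite eqn_leq pq leqNgt; apply/negP => pqi.
have /imsetP[j jD pij] : p i \in q @: D by rewrite -pqD imset_f.
have ji : (j < i)%N.
  rewrite ltnNge; apply/negP; rewrite leq_eqVlt => /predU1P[/val_inj ij|ij].
    by rewrite pij ij ltnn in pqi.
  by have := qmono _ _ iD jD ij; rewrite -pij ltnNge pq.
have pqj : p j = q j by apply: (IH j) => //; apply: leq_trans ji _.
by have := pmono _ _ jD iD ji; rewrite pij pqj ltnn.
Qed.

(** * Minimal cardinalities and the coding bound *)

Section spanning.
Context {R : realType} {X : metricType R}.

Lemma min_card_le (A : set {fset X}) (E : {fset X}) :
  A E -> (min_card A <= (#|` E|%:R)%:E :> \bar R)%E.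
Proof. by move=> AE; apply: ereal_inf_lbound; exists E. Qed.

Lemma min_card_attained (A : set {fset X}) : A !=set0 ->
  exists2 E, A E & min_card A = (#|` E|%:R)%:E :> \bar R.
Proof.
move=> [E0 AE0].
have exn : exists m, `[< exists2 E, A E & #|` E| = m >].
  by exists #|` E0|; apply/asboolP; exists E0.
case: (ex_minnP exn) => m /asboolP[E AE Em] mmin.
exists E => //; apply/eqP; rewrite eq_le min_card_le//=.
apply: le_ereal_inf_tmp => _ [E' AE' <-]; rewrite lee_fin ler_nat Em.
by apply: mmin; apply/asboolP; exists E'.
Qed.

Lemma min_card_pinfty (A : set {fset X}) :
  ~ (A !=set0) -> min_card A = +oo%E :> \bar R.
Proof.
move=> A0; rewrite /min_card (_ : A = set0) ?image_set0 ?ereal_inf0//.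
by apply/eqP; apply: contrapT => /negP/set0P.
Qed.

Lemma le_spanning_number (near near' : X -> X -> Prop) :
  (forall x y, near' x y -> near x y) ->
  (spanning_number near <= spanning_number near')%E.
Proof.
move=> nn; apply: ereal_inf_le_tmp => _ [E sE <-]; exists E => // x.
by have [y yE /nn] := sE x; exists y.
Qed.

(** One representative per code forms a spanning set; [x0] stands in for codes that no point has. *)
Lemma spanning_number_le_card (K : finType) (near : X -> X -> Prop)
    (code : X -> K -> Prop) (x0 : X) :
  (forall x, exists c, code x c) ->
  (forall x x' c, code x c -> code x' c -> near x x') ->
  (spanning_number near <= (#|K|%:R)%:E)%E.
Proof.
move=> codeE code_near.
have [rep repP] : {rep : K -> X & forall c x, code x c -> code (rep c) c}.
  apply: (@choice _ _ (fun c z => forall x, code x c -> code z c)) => c.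
  have [[x cx]|nc] := pselect (exists x, code x c); first by exists x.
  by exists x0 => x cx; case: nc; exists x.
pose E := [fset rep c | c in K]%fset.
apply: (@le_trans _ _ (#|` E|%:R)%:E).
  apply: min_card_le => x; have [c xc] := codeE x.
  by exists (rep c); [exact: in_imfset|exact: (code_near _ _ c) (repP _ _ xc)].
rewrite lee_fin ler_nat; apply: leq_trans (leq_imfset_card _ _ _) _.
by rewrite cardT.
Qed.

End spanning.

(** * Counting codes at the Bowen scale *)

Section counting.
Context {R : realType} {X : metricType R} (T : X -> X).

Lemma r_Bowen_counting (n k : nat) (delta : R) (near : X -> X -> Prop)
    (E C : {fset X}) : 0 < delta ->
  (forall x, exists2 y, y \in E & near x y) ->
  [set: X] `<=` \bigcup_(c in [set` C]) ball c delta ->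
  (forall x y, near x y -> exists D p, is_match T (n := n) delta x y D p /\
     (n - #|D| <= k)%N) ->
  (r_Bowen T n (2 * delta) <= ((#|` E| * 4 ^ n * #|` C| ^ k)%:R)%:E)%E.
Proof.
move=> delta0 sE covC nearP.
have [x0|noX] := pselect (exists x0 : X, True); last first.
  apply: (@le_trans _ _ (#|` (fset0 : {fset X})|%:R)%:E).
    by apply: min_card_le => x; case: noX; exists x.
  by rewrite cardfs0 lee_fin ler0n.
case: x0 => x0 _.
have [ctr ctrP] : {ctr : X -> C & forall z, mdist (val (ctr z)) z < delta}.
  apply: (@choice X C (fun z c => mdist (val c) z < delta)) => z.
  have [c /= cC] := covC z Logic.I.
  by rewrite ballEmdist => cz; exists [` cC]%fset.
(* [x] is coded by the point [y] it is matched with, the domain and the range of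
   the match, and the centres of balls that contain it at the missed times. *)
pose K := (E * {set 'I_n} * {set 'I_n} * {ffun 'I_k -> C})%type.
(* Indices past the last missed time fall back on time 0, so that every code carries exactly [k]
   centres. *)
pose missed (D : {set 'I_n}) j :=
  nth 0%N [seq val i | i <- enum (~: D)] j.
pose code (x : X) (c : K) := let: (y, D, B, w) := c in
  exists p, [/\ is_match T delta x (val y) D p, p @: D = B,
    (n - #|D| <= k)%N &
    forall j, mdist (val (w j)) (iter (missed D j) T x) < delta].
have cardK : #|{: K}| = (#|` E| * 4 ^ n * #|` C| ^ k)%N.
  have card_set : #|{: {set 'I_n}}| = (2 ^ n)%N.
    by rewrite -cardsT -powersetT card_powerset cardsT card_ord.
  rewrite !card_prod !card_set card_ffun card_ord -!cardfE.
  by rewrite -[4%N]/(2 ^ 2)%N -expnM mul2n -addnn expnD mulnA.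
rewrite -cardK; apply: (spanning_number_le_card (code := code)) => //.
- move=> x; have [y yE /nearP[D [p [xyp Dk]]]] := sE x.
  exists ([` yE]%fset, D, p @: D,
    [ffun j : 'I_k => ctr (iter (missed D j) T x)]).
  by exists p; split=> // j; rewrite ffunE.
move=> x x' [[[y D] B] w] [p [[_ pmono pclose] pS Dk wclose]].
move=> [p' [[_ pmono' pclose'] pS' _ wclose']].
apply: bigmax_lt => [|i _]; first by rewrite mulr_gt0.
(* The common point [z] is the matched iterate of [y] at a time in [D], and the recorded ball centre
   at a missed time. At times in [D], the matches of [x] and [x'] agree because they share domain
   and range. *)
suff [z [xz x'z]] : exists z, mdist z (iter i T x) < delta /\
    mdist z (iter i T x') < delta.
  rewrite (le_lt_trans (metric_triangle _ z _))// mulr_natl mulr2n ltrD//.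
  by rewrite metric_sym.
have [iD|iD] := boolP (i \in D).
  exists (iter (p i) T (val y)); rewrite ![mdist (iter (p i) T _) _]metric_sym.
  split; first exact: pclose.
  rewrite (increasing_image_inj pmono pmono' _ iD) ?pS ?pS'//.
  exact: pclose'.
have iD' : i \in enum (~: D) by rewrite mem_enum inE.
have jk : (index i (enum (~: D)) < k)%N.
  have nD : (n - #|D|)%N = #|~: D|.
    by rewrite [RHS]cardsCs finset.setCK card_ord.
  by rewrite (leq_trans _ Dk)// nD cardE index_mem.
have missedi : missed D (Ordinal jk) = i.
  by rewrite /missed (nth_map i) ?index_mem//= nth_index.
exists (val (w (Ordinal jk))); rewrite -[nat_of_ord i]missedi.
by split; [exact: wclose|exact: wclose'].
Qed.

End counting.

(** * Limits superior in the extended reals *)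

(** Reduces a comparison to real bounds [K], so that infinite values of [y] need no separate
    treatment later. *)
Lemma lee_lt_EFin {R : realType} (x y : \bar R) :
  (forall K : R, (y < K%:E)%E -> (x <= K%:E)%E) -> (x <= y)%E.
Proof.
case: y => [r| |] h; last first.
- case: x h => [s| |] h //; last by have := h 0 (ltNyr _); rewrite leye_eq.
  by have := h (s - 1) (ltNyr _); rewrite lee_fin leNgt ltrBlDr ltrDl ltr01.
- exact: leey.
by apply/lee_addgt0Pr => e e0; apply: h; rewrite lte_fin ltrDl.
Qed.

Section limf_esup.
Context {R : realType} {T : choiceType} {X : filteredType T}.
Context (F : set_system X) {FF : Filter F}.
Implicit Types f g : X -> \bar R.

Lemma limf_esup_lt_near f y :
  (limf_esup f F < y)%E -> \forall x \near F, (f x < y)%E.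
Proof.
move=> /ereal_inf_lt[_ [V FV <-] Vy]; apply: filterS FV => x Vx.
by apply: le_lt_trans Vy; apply: ereal_sup_ubound; exists x.
Qed.

Lemma le_limf_esup f g : (\forall x \near F, (f x <= g x)%E) ->
  (limf_esup f F <= limf_esup g F)%E.
Proof.
move=> fg; apply: le_ereal_inf_tmp => _ [V FV <-]; apply: ge_ereal_inf.
exists (ereal_sup (f @` (V `&` [set x | (f x <= g x)%E]))).
  by eexists; [exact: filterI FV fg|].
apply: ge_ereal_sup => _ [x [Vx fgx] <-]; apply: le_trans fgx _.
by apply: ereal_sup_ubound; exists x.
Qed.

Lemma limf_esup_le_near f y : (\forall x \near F, (f x <= y)%E) ->
  (limf_esup f F <= y)%E.
Proof.
move=> fy; apply: ge_ereal_inf.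
exists (ereal_sup (f @` [set x | (f x <= y)%E])).
  by eexists; first exact: fy.
by apply: ge_ereal_sup => _ [x fxy <-].
Qed.

Lemma limf_esup_pZl f (c : R) : 0 < c ->
  limf_esup (fun x => c%:E * f x)%E F = (c%:E * limf_esup f F)%E.
Proof.
move=> c0; rewrite /limf_esup -ereal_inf_pZl// image_comp.
congr ereal_inf; apply: eq_imagel => V _ /=.
by rewrite -ereal_sup_pZl// image_comp.
Qed.

End limf_esup.

(** * Scales tending to 0 from the right *)

Section near_right0.
Context {R : realType}.

Lemma near_right0_powR (P : R -> Prop) (c a : R) : 0 < c -> 0 < a ->
  (\forall e \near 0^'+, P e) -> \forall e \near 0^'+, P (c * e `^ a).
Proof.
move=> c0 a0; rewrite near_withinE => /nbhs_ballP[d /= d0 dP].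
(* This radius solves [c * e ^ a = d]. *)
have dc0 : 0 < (d / c) `^ a^-1 by apply: powR_gt0; rewrite divr_gt0.
near=> e.
have e0 : 0 < e by near: e; exact: nbhs_right_gt.
have ce0 : 0 < c * e `^ a by rewrite mulr_gt0// powR_gt0.
apply: dP => //; rewrite /ball/= sub0r normrN gtr0_norm//.
rewrite mulrC -ltr_pdivlMr//.
suff : e `^ a < ((d / c) `^ a^-1) `^ a.
  by rewrite -powRrM mulVf ?gt_eqF// powRr1 ?divr_ge0 ?(ltW d0) ?(ltW c0).
apply: gt0_ltr_powR; rewrite ?nnegrE ?(ltW e0) ?(ltW dc0)//.
Unshelve. all: by end_near. Qed.

Lemma near_right0_lnV (c : R) : \forall e \near 0^'+, c < ln e^-1.
Proof.
near=> e.
have e0 : 0 < e by near: e; exact: nbhs_right_gt.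
rewrite lnV ?posrE// ltrNr -ltr_expR lnK ?posrE//.
by near: e; apply: nbhs_right_lt; exact: expR_gt0.
Unshelve. all: by end_near. Qed.

End near_right0.

(** * Mean dimensions in a common form *)

Section mdim.
Context {R : realType} {X : metricType R} (T : X -> X).
Hypothesis X0 : [set: X] !=set0.
Implicit Types near : nat -> R -> X -> X -> Prop.

(* The four quantities of the theorem are of this form; [near n e] stands for
   closeness at scale [e] for the metric indexed by [n]. *)
Definition span_rate near (e : R) : \bar R :=
  limn_esup (fun n =>
    ((n%:R * ln e^-1)^-1)%:E * lne (spanning_number (near n e)))%E.

Definition mdim near : \bar R := limf_esup (span_rate near) 0^'+.

(** Once [e < 1], the factor [1 / ln (1 / e)] is a positive real and passes through the inner limit
    superior. *)
Lemma mdim_scaled near :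
  limf_esup (fun e : R => ((ln e^-1)^-1)%:E * limn_esup (fun n =>
    (n%:R^-1)%:E * lne (spanning_number (near n e))))%E 0^'+ = mdim near.
Proof.
have rateE : \forall e \near (0 : R)^'+,
    (((ln e^-1)^-1)%:E * limn_esup (fun n =>
    (n%:R^-1)%:E * lne (spanning_number (near n e))) = span_rate near e)%E.
  near=> e; rewrite -limf_esup_pZl; last first.
    by rewrite invr_gt0; near: e; exact: near_right0_lnV.
  by congr limf_esup; apply/funext => n; rewrite muleA -EFinM invfM mulrC.
by apply/eqP; rewrite eq_le; apply/andP; split; apply: le_limf_esup;
  apply: filterS rateE => e ->.
Unshelve. all: by end_near. Qed.

Lemma spanning_number_ge1 (near : X -> X -> Prop) :
  (1 <= spanning_number near)%E.
Proof.
apply: le_ereal_inf_tmp => _ [E sE <-]; rewrite lee_fin ler1n.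
have [x _] := X0; have [y yE _] := sE x.
by rewrite cardfs_gt0; apply/fset0Pn; exists y.
Qed.

Lemma spanning_number_itv (near : X -> X -> Prop) :
  spanning_number near \in `[0%E, +oo%E :> \bar R].
Proof. by rewrite in_itv/= leey andbT (le_trans _ (spanning_number_ge1 _)). Qed.

Lemma le_mdim near near' :
  (forall n e x y, (0 < n)%N -> 0 < e -> near' n e x y -> near n e x y) ->
  (mdim near <= mdim near')%E.
Proof.
move=> nn; apply: le_limf_esup; near=> e; apply: le_limf_esup; near=> n.
have e0 : 0 < e by near: e; exact: nbhs_right_gt.
have l0 : 0 < ln e^-1 by near: e; exact: near_right0_lnV.
rewrite lee_wpmul2l// ?lee_fin ?invr_ge0 ?mulr_ge0 ?(ltW l0)//.
rewrite lee_lne ?spanning_number_itv//; apply: le_spanning_number => x y.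
apply: nn => //.
by near: n; exact: nbhs_infty_gt.
Unshelve. all: by end_near. Qed.

Lemma mdim_ge0 near : (0 <= mdim near)%E.
Proof.
have : (0 <= limf_esup (fun=> 0 : \bar R)%E (0 : R)^'+)%E.
  by apply: limf_esup_ge0 => //; exact: filter_not_empty.
move=> /le_trans; apply; apply: le_limf_esup; near=> e.
have : (0 <= limn_esup (fun=> 0 : \bar R)%E)%E.
  by apply: limf_esup_ge0 => //; exact: filter_not_empty.
move=> /le_trans; apply; apply: le_limf_esup; near=> n.
rewrite mule_ge0 ?lee_fin ?invr_ge0 ?mulr_ge0// ?lne_ge0 ?spanning_number_ge1//.
by apply/ltW; near: e; exact: near_right0_lnV.
Unshelve. all: by end_near. Qed.

(** The logarithm of the counting bound: [4 ^ n] contributes [n ln 4], and the centres contribute at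
    most [eta n ln N], which is at most [n]. *)
Lemma lne_r_Bowen_le (n : nat) (delta eta : R) (near : X -> X -> Prop) :
  0 < delta -> 0 < eta ->
  (eta%:E * lne (covering_number (X := X) delta) <= 1)%E ->
  (forall x y, near x y -> exists D p, is_match T (n := n) delta x y D p /\
     (n - #|D|)%:R <= eta * n%:R) ->
  (lne (r_Bowen T n (2 * delta)) <=
   lne (spanning_number near) + (n%:R * (ln 4 + 1))%:E)%E.
Proof.
move=> delta0 eta0 etaN nearP.
have [x0 _] := X0.
(* Without a finite cover the left side of [etaN] would be infinite, against the bound 1. *)
have [C covC CN] : exists2 C : {fset X},
    [set: X] `<=` \bigcup_(c in [set` C]) ball c delta &
    covering_number (X := X) delta = (#|` C|%:R)%:E.
  apply: min_card_attained; apply: contrapT => /(min_card_pinfty (R := R)) Ny.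
  move: etaN; rewrite /covering_number Ny /= gt0_muley ?lte_fin//.
have C1 : (0 < #|` C|)%N.
  have [c /= cC _] := covC x0 Logic.I.
  by rewrite cardfs_gt0; apply/fset0Pn; exists c.
have [sE|/(min_card_pinfty (R := R)) Ny] := pselect
    ([set E : {fset X} | forall x, exists2 y, y \in E & near x y] !=set0);
  last first.
  by rewrite /spanning_number Ny /= leey.
have [E {}sE EN] := min_card_attained (R := R) sE.
have E1 : (0 < #|` E|)%N.
  have [y yE _] := sE x0.
  by rewrite cardfs_gt0; apply/fset0Pn; exists y.
rewrite /spanning_number EN lne_EFin ?ltr0n//.
(* The number of misses is an integer, so rounding [eta n] down keeps it a bound. *)
set k := Num.truncn (eta * n%:R).
have kle : k%:R <= eta * n%:R by rewrite truncn_le// mulr_ge0// ltW.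
have : (r_Bowen T n (2 * delta) <= ((#|` E| * 4 ^ n * #|` C| ^ k)%:R)%:E)%E.
  apply: r_Bowen_counting sE covC _ => // x y /nearP[D [p [xyp Dn]]].
  by exists D, p; split; rewrite // truncn_ge_nat// mulr_ge0// ltW.
have prod0 : (0 < #|` E| * 4 ^ n * #|` C| ^ k)%N.
  by rewrite !muln_gt0 !expn_gt0 E1 C1.
have rB0 : r_Bowen T n (2 * delta) \in `[0%E, +oo%E].
  exact: spanning_number_itv.
have K0 (m : nat) : (m%:R)%:E \in `[0%E, +oo%E :> \bar R].
  by rewrite in_itv/= leey lee_fin ler0n.
rewrite -lee_lne// => /le_trans; apply.
rewrite lne_EFin ?ltr0n// -EFinD lee_fin.
rewrite !natrM !natrX lnM ?posrE ?mulr_gt0 ?exprn_gt0 ?ltr0n//.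
rewrite lnM ?posrE ?exprn_gt0 ?ltr0n// !lnXn ?ltr0n//.
rewrite -addrA lerD2l mulrDr mulr1 -[ln 4 *+ n]mulr_natl lerD2l.
move: etaN; rewrite CN lne_EFin ?ltr0n// -EFinM lee_fin => etaN.
rewrite -[_ *+ k]mulr_natl; apply: (@le_trans _ _ (eta * n%:R * ln #|` C|%:R)).
  by rewrite ler_wpM2r// ln_ge0// ler1n.
by rewrite mulrAC ler_piMl.
Qed.

End mdim.

(** * Comparison with the Bowen metric mean dimension *)

Section comparison.
Context {R : realType} {X : metricType R} (T : X -> X).
Hypothesis X0 : [set: X] !=set0.

(** The factor [a] is the cost of passing from scale [e] to [2 e ^ a]:
    [ln (1 / (2 e ^ a)) = a ln (1 / e) - ln 2]. *)
Lemma mdim_M_le (a : R) (eta : R -> R) (near : nat -> R -> X -> X -> Prop) :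
  0 < a ->
  (\forall e \near 0^'+, \forall n \near \oo, forall x y, near n e x y ->
     exists D p, is_match T (n := n) (e `^ a) x y D p /\
       (n - #|D|)%:R <= eta e * n%:R) ->
  (\forall e \near 0^'+, 0 < eta e /\
     ((eta e)%:E * lne (covering_number (X := X) (e `^ a)) <= 1)%E) ->
  (a%:E * mdim_M T <= mdim near)%E.
Proof.
move=> a0 nearP etaP; apply: lee_lt_EFin => K' LK'.
(* The gap [K' - K] will absorb the bounded terms [ln 4 + 1] and [K' ln 2 / a] as [ln (1 / e)]
   grows. *)
have [K LK KK'] : exists2 K : R, (mdim near < K%:E)%E & K < K'.
  have L0 := mdim_ge0 X0 near.
  have Lfin : mdim near \is a fin_num.
    by rewrite ge0_fin_numE// (lt_trans LK') ?ltry.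
  move: LK'; rewrite -(fineK Lfin) lte_fin => /midf_lt[lK Kl].
  by exists ((fine (mdim near) + K') / 2); rewrite ?lte_fin.
rewrite muleC -lee_pdivlMr// -EFinM.
suff rate2 : \forall e \near (0 : R)^'+,
    (span_rate (fun n e x y => (dist_Bowen T n x y < e)%R) (2 * e `^ a) <=
     (K' / a)%:E)%E.
  apply: limf_esup_le_near.
  (* Substituting [e = (s / 2) ^ (1 / a)] turns the scale [2 e ^ a] into [s]. *)
  have c0 : 0 < (2^-1 : R) `^ a^-1 by rewrite powR_gt0.
  have ai0 : 0 < a^-1 by rewrite invr_gt0.
  have := near_right0_powR c0 ai0 rate2; apply: filter_app; near=> s.
  have s0 : 0 < s by near: s; exact: nbhs_right_gt.
  rewrite -powRM ?invr_ge0 ?(ltW s0)// -powRrM mulVf ?gt_eqF//.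
  by rewrite powRr1 ?mulr_ge0 ?invr_ge0 ?(ltW s0)// mulVKf.
have rate1 := limf_esup_lt_near LK.
near=> e; apply: limf_esup_le_near.
have e0 : 0 < e by near: e; exact: nbhs_right_gt.
have rate1e : (span_rate near e < K%:E)%E by near: e; exact: rate1.
have rate1n := limf_esup_lt_near rate1e.
have [eta0 etaN] : 0 < eta e /\
    ((eta e)%:E * lne (covering_number (X := X) (e `^ a)) <= 1)%E.
  by near: e; exact: etaP.
near=> n.
have n0 : 0 < n%:R :> R by rewrite ltr0n; near: n; exact: nbhs_infty_gt.
have nr1 : (((n%:R * ln e^-1)^-1)%:E * lne (spanning_number (near n e)) <
    K%:E)%E.
  by near: n; exact: rate1n.
have npP : forall x y, near n e x y ->
     exists D p, is_match T (n := n) (e `^ a) x y D p /\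
       (n - #|D|)%:R <= eta e * n%:R.
  by near: n; near: e; exact: nearP.
have l0 : 0 < ln e^-1 by near: e; exact: near_right0_lnV.
(* [l1] makes [ln (1 / (2 e ^ a))] positive; [l2] is the final inequality solved for
   [ln (1 / e)]. *)
have l1 : ln 2 / a < ln e^-1 by near: e; exact: near_right0_lnV.
have l2 : (ln 4 + 1 + K' * (ln 2 / a)) / (K' - K) < ln e^-1.
  by near: e; exact: near_right0_lnV.
have ls : ln (2 * e `^ a)^-1 = a * ln e^-1 - ln 2.
  rewrite !lnV ?posrE ?mulr_gt0 ?powR_gt0// lnM ?posrE ?powR_gt0// ln_powR.
  by rewrite mulrN opprD addrC.
rewrite ltr_pdivrMr// mulrC in l1.
rewrite ltr_pdivrMr ?subr_gt0// in l2.
rewrite lte_pdivrMl ?mulr_gt0// in nr1.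
rewrite ls lee_pdivrMl ?mulr_gt0 ?subr_gt0//.
have ea0 : 0 < e `^ a by rewrite powR_gt0.
apply: le_trans (lne_r_Bowen_le X0 ea0 eta0 etaN npP) _.
apply: (@le_trans _ _ ((n%:R * ln e^-1 * K)%:E + (n%:R * (ln 4 + 1))%:E)%E).
  by rewrite leeD2r// EFinM ltW.
rewrite -EFinD -EFinM lee_fin -!mulrA -mulrDr ler_pM2l//.
have -> : (a * ln e^-1 - ln 2) * (K' / a) = ln e^-1 * K' - K' * (ln 2 / a).
  rewrite mulrBl; congr (_ - _); last by rewrite mulrCA.
  by rewrite mulrAC mulrCA divff ?mulr1 ?gt_eqF// mulrC.
move: l2; rewrite mulrBr; lra.
Unshelve. all: by end_near. Qed.

End comparison.

Lemma near_le1_cvg0 {R : realType} (f : R -> \bar R) :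
  (f e @[e --> 0^'+] --> 0)%E -> \forall e \near (0 : R)^'+, (f e <= 1)%E.
Proof.
move=> /fine_cvgP[ffin /cvgr_lt/(_ _ ltr01) f1]; near=> e.
have fe : f e \is a fin_num by near: e; exact: ffin.
by rewrite -(fineK fe) lee_fin ltW//; near: e; exact: f1.
Unshelve. all: by end_near. Qed.

(** * Matches obtained from each closeness relation *)

Section matches.
Context {R : realType} {X : metricType R} (T : X -> X).
Implicit Types (n : nat) (delta e : R) (x y : X).

Lemma is_match_id n delta x y (D : {set 'I_n}) :
  {in D, forall i : 'I_n, mdist (iter i T x) (iter i T y) < delta} ->
  is_match T delta x y D [ffun i => i].
Proof.
by move=> close; split=> [i j _ _|i j _ _|i /close]; rewrite !ffunE.
Qed.

Lemma max_match_ge n delta x y (D : {set 'I_n}) (p : {ffun 'I_n -> 'I_n}) :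
  is_match T delta x y D p -> (#|D| <= max_match T n delta x y)%N.
Proof.
by move=> Dp; exact/(leq_bigmax_cond (D, p))/asboolP.
Qed.

Lemma max_match_attained n delta x y : exists D p,
  is_match T (n := n) delta x y D p /\ #|D| = max_match T n delta x y.
Proof.
have [|[D p] /asboolP Dp DE] := @eq_bigmax_cond _
    [pred q | `[< is_match T (n := n) delta x y q.1 q.2 >]] (fun q => #|q.1|).
  apply/card_gt0P; exists (finset.set0, [ffun i => i]); apply/asboolP => /=.
  by apply: is_match_id => i; rewrite inE.
by exists D, p; split; rewrite // /max_match DE.
Qed.

Lemma dist_FK_match n e x y : (0 < n)%N -> 0 < e -> dist_FK T n x y < e ->
  exists D p, is_match T (n := n) e x y D p /\ (n - #|D|)%:R <= e * n%:R.
Proof.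
move=> n0 e0 /inf_lt[|delta [delta0 fd] de].
  (* The infimum is over a nonempty set: [fbar] never exceeds 1, so 2 is admissible. *)
  exists 2; split; first by [].
  apply: (@le_lt_trans _ _ 1); last by rewrite ltr1n.
  by rewrite /fbar gerBl mulr_ge0 ?invr_ge0.
have [D [p [[pinj pmono pclose] DE]]] := max_match_attained n delta x y.
exists D, p; split; first by split=> // i /pclose /lt_trans; apply.
have Dn : (#|D| <= n)%N by rewrite -[leqRHS]card_ord max_card.
rewrite natrB//; apply: (@le_trans _ _ (delta * n%:R)).
  move/ltW: fd; rewrite /fbar -DE => fd.
  apply: le_trans (ler_wpM2r (ler0n _ n) fd).
  by rewrite mulrBl mul1r mulrAC mulVf ?mul1r// pnatr_eq0 -lt0n.
by rewrite ler_wpM2r// ltW.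
Qed.

Lemma dist_Bowen_ge0 n x y : 0 <= dist_Bowen T n x y.
Proof. exact: bigmax_ge_id. Qed.

Lemma dist_on_ltP n (L : {set 'I_n}) e x y : dist_on T L x y < e ->
  {in L, forall i : 'I_n, mdist (iter i T x) (iter i T y) < e}.
Proof. by move=> /bigmax_ltP[_]. Qed.

Lemma dist_Bowen_FK n e x y : (0 < n)%N ->
  dist_Bowen T n x y < e -> dist_FK T n x y < e.
Proof.
(* The midpoint [m] lies strictly above the Bowen distance, so the identity on all times is a match
   at scale [m], and strictly below [e], so the infimum stays below [e]. *)
move=> n0 /midf_lt[Bm me].
set m := (_ + _) / _ in Bm me.
have m0 : 0 < m by rewrite (le_lt_trans (dist_Bowen_ge0 n x y)).
apply: le_lt_trans me; apply: ge_inf; first by exists 0 => d [/ltW].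
split=> //; have /max_match_ge := is_match_id (dist_on_ltP Bm).
rewrite cardsT card_ord => nm; rewrite /fbar (le_lt_trans _ m0)//.
by rewrite subr_le0 ler_pdivlMl ?ltr0n// mulr1 ler_nat.
Qed.

Lemma dist_Bowen_mean n e x y : (0 < n)%N ->
  dist_Bowen T n x y < e -> dist_mean T n x y < e.
Proof.
move=> n0; apply: le_lt_trans; rewrite ler_pdivrMl ?ltr0n//.
apply: (@le_trans _ _ (\sum_(j < n) dist_Bowen T n x y)).
  by apply: ler_sum => j _; apply: le_bigmax_cond; rewrite inE.
by rewrite sumr_const card_ord mulr_natl.
Qed.

(** Markov's inequality: under the identity match, each missed time adds at least [delta] to the sum
    of distances. *)
Lemma dist_mean_match n delta eta x y : 0 < delta ->
  dist_mean T n x y <= delta * eta ->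
  exists D p, is_match T (n := n) delta x y D p /\ (n - #|D|)%:R <= eta * n%:R.
Proof.
move=> delta0 xy.
pose D := [set j : 'I_n | mdist (iter j T x) (iter j T y) < delta]%SET.
exists D, [ffun i => i]; split; first by apply: is_match_id => i; rewrite inE.
have -> : (n - #|D|)%N = #|~: D| by rewrite [RHS]cardsCs finset.setCK card_ord.
rewrite -(ler_pM2l delta0) mulrA.
have : \sum_(j < n) mdist (iter j T x) (iter j T y) <= delta * eta * n%:R.
  (* For [n = 0] the mean is 0 by convention and [xy] says nothing; the sum is then empty. *)
  have [n0|n0] := posnP n; last first.
    by move: xy; rewrite /dist_mean ler_pdivrMl ?ltr0n// mulrC.
  rewrite big1 => [|[j jn] _]; first by rewrite n0 mulr0.
  by exfalso; rewrite n0 in jn.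
apply: le_trans.
rewrite (bigID (mem D))/= -[leLHS]add0r lerD ?sumr_ge0//.
  by move=> i _; exact: mdist_ge0.
rewrite mulr_natr -sumr_const.
rewrite (eq_bigl (fun i => i \notin D)) => [|i]; last first.
  by rewrite inE.
by apply: ler_sum => i; rewrite inE -leNgt.
Qed.

End matches.

(** * The equalities under the growth conditions *)

Section equalities.
Context {R : realType} {X : metricType R} (T : X -> X).
Hypothesis X0 : [set: X] !=set0.

Lemma near_weak_tame : weak_tame_growth X ->
  \forall e \near (0 : R)^'+, 0 < e /\
    (e%:E * lne (covering_number (X := X) (e `^ 1)) <= 1)%E.
Proof.
move=> /near_le1_cvg0 weak; near=> e.
have e0 : 0 < e by near: e; exact: nbhs_right_gt.
by split=> //; rewrite powRr1 ?(ltW e0)//; near: e; exact: weak.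
Unshelve. all: by end_near. Qed.

Lemma weak_tame_growth_of_tame : tame_growth X -> weak_tame_growth X.
Proof.
move=> /(_ 1 ltr01); apply: cvg_trans; apply: near_eq_cvg; near=> e.
by rewrite powRr1//; near: e; exact: nbhs_right_ge.
Unshelve. all: by end_near. Qed.

Lemma mdim_FK_eq : weak_tame_growth X -> mdim_FK T = mdim_M T.
Proof.
move=> weak; apply/eqP; rewrite eq_le; apply/andP; split.
  rewrite [leLHS](mdim_scaled (fun n e x y => dist_FK T n x y < e)).
  by apply: le_mdim => // n e x y n0 _; exact: dist_Bowen_FK.
rewrite [leRHS](mdim_scaled (fun n e x y => dist_FK T n x y < e)) -[leLHS]mul1e.
apply: (@mdim_M_le _ _ T X0 1 id) => //; last exact: near_weak_tame.
near=> e; near=> n => x y.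
have e0 : 0 < e by near: e; exact: nbhs_right_gt.
rewrite powRr1 ?(ltW e0)//; apply: dist_FK_match => //.
by near: n; exact: nbhs_infty_gt.
Unshelve. all: by end_near. Qed.

Lemma mdim_mistake_eq (g : nat -> nat) : mistake_function R g ->
  weak_tame_growth X -> mdim_mistake T g = mdim_M T.
Proof.
move=> [_ _ _ gn0] weak; pose near n e x y :=
  exists2 L, mistake_sets g n L & dist_on T L x y < e.
apply/eqP; rewrite eq_le; apply/andP; split.
  rewrite [leLHS](mdim_scaled near).
  apply: le_mdim => // n e x y n0 _ xy; exists [set: 'I_n]%SET => //.
  by rewrite /mistake_sets/= cardsT card_ord leq_subr.
rewrite [leRHS](mdim_scaled near) -[leLHS]mul1e.
apply: (@mdim_M_le _ _ T X0 1 id) => //; last exact: near_weak_tame.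
near=> e; have e0 : 0 < e by near: e; exact: nbhs_right_gt.
(* At most [g n] times are missed, and [g n < e n] for large [n], whence [eta = e]. *)
have ge := cvgr_lt _ gn0 _ e0.
near=> n => x y [L Ln xy]; rewrite powRr1 ?(ltW e0)//.
exists L, [ffun i => i]; split; first exact: is_match_id (dist_on_ltP xy).
have n0 : (0 < n)%N by near: n; exact: nbhs_infty_gt.
apply: (@le_trans _ _ (g n)%:R); first by rewrite ler_nat leq_subCl.
rewrite -ler_pdivrMr ?ltr0n// ltW//; near: n; exact: ge.
Unshelve. all: by end_near. Qed.

Lemma mdim_mean_eq : tame_growth X -> mdim_mean T = mdim_M T.
Proof.
move=> tame; apply/eqP; rewrite eq_le; apply/andP; split.
  by apply: le_mdim => // n e x y n0 _; exact: dist_Bowen_mean.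
(* The loss of a factor [a < 1] disappears by letting [a] tend to 1. *)
apply/lee_mul01Pr; first exact: mdim_ge0.
move=> a /andP[a0 a1]; have b0 : 0 < 1 - a by rewrite subr_gt0.
apply: (@mdim_M_le _ _ T X0 a (fun e => e `^ (1 - a))) => //.
  near=> e; near=> n => x y xy.
  have e0 : 0 < e by near: e; exact: nbhs_right_gt.
  apply: dist_mean_match; first by rewrite powR_gt0.
  (* The bound [e] splits as [e ^ a * e ^ (1 - a)]: closeness threshold times proportion of
     misses. *)
  rewrite -powRD; last by rewrite (gt_eqF e0) implybT.
  by rewrite addrCA subrr addr0 powRr1 ?(ltW e0)// ltW.
(* In terms of the covering scale [s = e ^ a], the proportion [e ^ (1 - a)] is [s ^ ((1 - a) / a)],
   which fixes the exponent for tame growth. *)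
have th0 : 0 < (1 - a) / a by rewrite divr_gt0.
have := near_right0_powR ltr01 a0 (near_le1_cvg0 (tame _ th0)).
apply: filter_app; near=> e => /=.
have e0 : 0 < e by near: e; exact: nbhs_right_gt.
by rewrite mul1r -powRrM mulrC divfK ?gt_eqF// powR_gt0.
Unshelve. all: by end_near. Qed.

End equalities.

Theorem theorem1p1 (R : realType) (X : metricType R) (T : X -> X)
    (g : nat -> nat)
    (X_nonempty : [set: X] !=set0)
    (X_compact : compact [set: X])
    (T_homeo : homeomorphism T)
    (g_mistake : mistake_function R g) :
  (weak_tame_growth X ->
     mdim_FK T = mdim_M T /\ mdim_M T = mdim_mistake T g) /\
  (tame_growth X ->
     [/\ mdim_FK T = mdim_M T,
         mdim_M T = mdim_mean T
       & mdim_mean T = mdim_mistake T g]).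
Proof.
have main (weak : weak_tame_growth X) :
    mdim_FK T = mdim_M T /\ mdim_M T = mdim_mistake T g.
  split; first exact (mdim_FK_eq T X_nonempty weak).
  exact (esym (mdim_mistake_eq T X_nonempty g_mistake weak)).
split=> [|tame]; first exact main.
have [FK mistake] := main (weak_tame_growth_of_tame tame).
have mean := mdim_mean_eq T X_nonempty tame.
by split; [exact FK|exact (esym mean)|exact (etrans mean mistake)].
Qed.
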